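(* For any $n\in\mathbb{N}$, $$|\mathcal{L}_1^o(2n)|=c^{(\pm1)}_{\underbrace{-1,\dots,-1}_{n\text{ times}},\,\underbrace{1,\dots,1}_{n\text{ times}}}=\Big|\textstyle\sum_{2n}^{(1)}\Big|,$$ where $c^{(\pm1)}_{-1,\dots,-1,1,\dots,1}$ is the $(-1,\dots,-1,1,\dots,1)$-th coefficient of the $2n$-th power $(a_{-1}+a_1)^{2n}$ of the binomial $a_{-1}+a_1$. Equivalently, $$|\mathcal{L}_1^o(2n)|=\binom{2n}{n}=\Big|\textstyle\sum_{2n}^{(1)}\Big|\quad\text{for all }n\in\mathbb{N}.$$
   Context: In $\mathbb{R}^2$ let $l_1=(1,e)$ and $l_{-1}=(1,-e)$, where $e$ is the base of the natural logarithm. A lattice path of length $m$ is a word $l_{i_1}\cdots l_{i_m}$, $i_j\in\{\pm1\}$, viewed as the path from $(0,0)$ obtained by concatenating these vectors; $\mathcal{L}_1^o(m)$ is the set of those of length $m$ that end on the horizontal axis, i.e. at $(m,0)$. $\sum_m^{(1)}=\{(t_1,\dots,t_m)\in\{1,-1\}^m: t_1+\cdots+t_m=0\}$. $a_{-1},a_1$ are distinct elements (treated as formal commuting variables) of a commutative unital algebra; the $(i_1,\dots,i_m)$-th coefficient ($i_1\le\cdots\le i_m$, $i_j\in\{-1,1\}$) of $(a_{-1}+a_1)^m$ is the integer coefficient of the monomial $a_{i_1}\cdots a_{i_m}$ after collecting equal monomials using commutativity. *)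

(* Defs.v *)
From mathcomp Require Import all_boot all_order all_algebra.
From mathcomp Require Import reals.
From mathcomp Require analysis.sequences.
From mathcomp Require Import mpoly.

Set Implicit Arguments.
Unset Strict Implicit.
Unset Printing Implicit Defensive.

Import GRing.Theory Num.Theory.
Local Open Scope ring_scope.

Definition pm1 : finType := seq_sub [:: -1; 1 : int].
Definition neg1 : pm1 := @SeqSub _ [:: -1; 1 : int] (-1) isT.
Definition pos1 : pm1 := @SeqSub _ [:: -1; 1 : int] 1 isT.

Definition lvec (R : realType) (i : pm1) : R * R :=
  if i == pos1 then (1, sequences.expR 1) else (1, - sequences.expR 1).

(* Letters are the vectors themselves; a word of length m is an m-tuple of
   them, read as the path from the origin with these successive steps. *)
Definition step (R : realType) : finType :=
  seq_sub [:: lvec R neg1; lvec R pos1].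

Definition endpoint (R : realType) (m : nat) (w : m.-tuple (step R)) : R * R :=
  \sum_(s <- w) ssval s.

Definition L1o (R : realType) (m : nat) : {set m.-tuple (step R)} :=
  [set w | endpoint w == (m%:R, 0)].

Definition Sigma1 (m : nat) : {set m.-tuple pm1} :=
  [set t : m.-tuple pm1 | \sum_(x <- t) ssval x == 0 :> int].

(* The commuting variables a_{-1}, a_1 are 'X_0, 'X_1 in int[X_0, X_1]. *)
Definition var_idx (i : pm1) : 'I_2 := if i == pos1 then 1 else 0.
Definition avar (i : pm1) : {mpoly int[2]} := 'X_(var_idx i).

(* For I = (i_1, ..., i_m), the multinomial \sum_(i <- I) U_(var_idx i) is the
   exponent of the monomial a_{i_1} ... a_{i_m}. *)
Definition binom_pow_coef (m : nat) (I : seq pm1) : int :=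
  ((avar neg1 + avar pos1) ^+ m)@_(\sum_(i <- I) U_(var_idx i))%MM.

(* Main.v *)
Require Import Defs.
From mathcomp Require Import all_boot all_order all_algebra.
From mathcomp Require Import reals.
From mathcomp Require analysis.exp.
From mathcomp Require Import mpoly.
From mathcomp Require Import zify ring.

Set Implicit Arguments.
Unset Strict Implicit.
Unset Printing Implicit Defensive.

Import GRing.Theory Num.Theory.
Local Open Scope ring_scope.

(** All three numbers count the words of length [2n] over a two-letter alphabet
    in which each letter occurs [n] times, and there are ['C(2n, n)] of them,
    one for each [n]-element set of positions of the second letter
    ([card_tuple_count]).

    For paths and for sign sequences the two letters carry opposite nonzero
    weights [- v] and [v], where [v] is [e] for the heights of the steps and
    [1] for the signs.  The total weight of a word is [v] times the difference
    of the two numbers of occurrences, so it vanishes exactly for balanced words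
    ([sum_opp_letters_eq0], [card_balanced]).  As every step has abscissa [1], a
    path of length [2n] ends at [(2n, 0)] exactly when its heights sum to [0]
    ([fst_endpoint]).  The coefficient is read off the binomial theorem, where
    only the term of degree [n] in [a_1] has the right monomial. *)

(** * Balanced words over two letters *)

(** Over a two-letter alphabet a word is determined by the set of positions of
    one letter, which turns the count into that of the [k]-subsets of ['I_m]. *)
Lemma card_tuple_count (T : finType) (a b : T) (m k : nat) :
    a != b -> (forall x, (x == a) || (x == b)) ->
  #|[set t : m.-tuple T | count_mem b t == k]| = 'C(m, k).
Proof.
move=> neq_ab abP.
pose pos (t : m.-tuple T) := [set i : 'I_m | tnth t i == b].
have pos_inj : injective pos.
  move=> s t /setP eq_st; apply: eq_from_tnth => i.
  have := eq_st i; rewrite !inE.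
  have := abP (tnth s i); have := abP (tnth t i).
  by do 2![case/orP=> /eqP->]; rewrite ?eqxx ?(negPf neq_ab).
have card_pos t : #|pos t| = count_mem b t.
  rewrite -sum1_card -sum1_count big_tuple; apply: eq_bigl => i.
  by rewrite inE.
rewrite -[in RHS](card_ord m) -card_draws -(card_imset _ pos_inj).
congr #|pred_of_set _|; apply/setP=> A; rewrite inE; apply/imsetP/idP.
  by case=> t; rewrite inE -card_pos => cardA ->.
move=> cardA; pose t := [tuple if i \in A then b else a | i < m].
have posA : pos t = A.
  apply/setP=> i; rewrite inE tnth_mktuple.
  by case: ifP; rewrite ?eqxx ?(negPf neq_ab).
by exists t; rewrite ?inE -?card_pos posA.
Qed.

Lemma size_two_letters (T : eqType) (a b : T) (s : seq T) :
    a != b -> (forall x, (x == a) || (x == b)) ->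
  size s = (count_mem a s + count_mem b s)%N.
Proof.
move=> neq_ab abP; rewrite -(count_predC (pred1 a) s); congr addn.
apply: eq_count => x /=; case/orP: (abP x) => /eqP->; rewrite ?eqxx.
  by rewrite (negPf neq_ab).
by rewrite eq_sym neq_ab.
Qed.

(** The sum is [f b] times the difference of the two numbers of occurrences, and
    a numeric domain has characteristic zero and no zero divisors. *)
Lemma sum_opp_letters_eq0 (D : numDomainType) (T : eqType) (a b : T)
    (f : T -> D) (s : seq T) :
    a != b -> (forall x, (x == a) || (x == b)) ->
    f a = - f b -> f b != 0 ->
  (\sum_(x <- s) f x == 0) = (count_mem a s == count_mem b s).
Proof.
move=> neq_ab abP fa fb0.
have -> : \sum_(x <- s) f x = f b * ((count_mem b s)%:R - (count_mem a s)%:R).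
  elim: s => [|x s IHs]; first by rewrite big_nil subrr mulr0.
  rewrite big_cons IHs /=; case/orP: (abP x) => /eqP->; rewrite eqxx.
    by rewrite (negPf neq_ab) fa add0n add1n -natr1; ring.
  by rewrite eq_sym (negPf neq_ab) add0n add1n -natr1; ring.
by rewrite mulf_eq0 (negPf fb0) subr_eq0 eqr_nat eq_sym.
Qed.

Lemma card_balanced (D : numDomainType) (T : finType) (a b : T) (f : T -> D)
    (n : nat) :
    a != b -> (forall x, (x == a) || (x == b)) ->
    f a = - f b -> f b != 0 ->
  #|[set t : (2 * n).-tuple T | \sum_(x <- t) f x == 0]| = 'C(2 * n, n).
Proof.
move=> neq_ab abP fa fb0; rewrite -(card_tuple_count _ n neq_ab abP).
apply: eq_card => t; rewrite !inE (sum_opp_letters_eq0 _ neq_ab abP fa fb0).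
have := size_two_letters t neq_ab abP; rewrite size_tuple => sz.
by apply/eqP/eqP; lia.
Qed.

(** * Signs, paths and the binomial coefficient *)

Lemma pm1P (x : pm1) : (x == neg1) || (x == pos1).
Proof. by have := ssvalP x; rewrite !inE. Qed.

Lemma card_Sigma1 (n : nat) : #|Sigma1 (2 * n)| = 'C(2 * n, n).
Proof. exact: (card_balanced (f := @ssval _ _) n _ pm1P). Qed.

Lemma fst_endpoint (R : realType) (m : nat) (w : m.-tuple (step R)) :
  (endpoint w).1 = m%:R.
Proof.
have fst1 (s : step R) : (ssval s).1 = 1.
  by have := ssvalP s; rewrite !inE => /orP[]/eqP->; rewrite /lvec.
rewrite /endpoint raddf_sum /= (eq_bigr (fun=> 1)) => [|s _]; last exact: fst1.
by rewrite big_const_seq count_predT size_tuple iter_addr_0.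
Qed.

Lemma card_L1o (R : realType) (n : nat) : #|L1o R (2 * n)| = 'C(2 * n, n).
Proof.
have e0 : sequences.expR 1 != 0 :> R by rewrite lt0r_neq0 ?exp.expR_gt0.
have lvecN : lvec R neg1 = (1, - sequences.expR 1) by [].
have lvecP : lvec R pos1 = (1, sequences.expR 1) by [].
have memN : lvec R neg1 \in [:: lvec R neg1; lvec R pos1] by rewrite inE eqxx.
have memP : lvec R pos1 \in [:: lvec R neg1; lvec R pos1].
  by rewrite !inE eqxx orbT.
pose sN : step R := SeqSub memN; pose sP : step R := SeqSub memP.
have neq : sN != sP.
  by rewrite -(inj_eq val_inj) /= lvecN lvecP xpair_eqE eqxx eqNr.
have stepP (x : step R) : (x == sN) || (x == sP).
  by have := ssvalP x; rewrite !inE -!(inj_eq val_inj).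
rewrite -(card_balanced (f := fun s : step R => (ssval s).2) n neq stepP) //.
apply: eq_card => w; rewrite !inE [endpoint w]surjective_pairing.
by rewrite xpair_eqE fst_endpoint eqxx /endpoint raddf_sum.
Qed.

Lemma binom_pow_coef_central (n : nat) :
  binom_pow_coef (2 * n) (nseq n neg1 ++ nseq n pos1) = 'C(2 * n, n)%:Z.
Proof.
rewrite /binom_pow_coef /avar /var_idx eqxx /=.
set J := (\sum_(i <- _) _)%MM.
have -> : J = (U_(0%R) *+ n + U_(1%R) *+ n)%MM.
  apply/mnmP=> j; rewrite /J mnm_sumE big_cat /= !big_nseq mnmDE !mulmnE.
  by rewrite !iter_addn_0 !(mulnC _ n).
rewrite exprDn raddf_sum /=.
have termE (i : 'I_(2 * n).+1) :
    (('X_(0%R) ^+ (2 * n - i) * 'X_(1%R) ^+ i) *+ 'C(2 * n, i) : {mpoly int[2]})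
      @_(U_(0%R) *+ n + U_(1%R) *+ n)%MM
    = if i == n :> nat then 'C(2 * n, n)%:Z else 0.
  rewrite !mpolyXn -mpolyXD mcoeffMn mcoeffX.
  case: (nat_of_ord i =P n) => [->|neq_in].
    by rewrite mul2n -addnn addnK eqxx natz.
  (* Equal monomials would have the same exponent in the second variable. *)
  case: (_ =P (U_(0%R) *+ n + _)%MM) => [/mnmP/(_ 1%R)|]; last by rewrite mul0rn.
  by rewrite !(mnmDE, mulmnE, mnm1E) /= !mul0n !mul1n !add0n.
rewrite (eq_bigr _ (fun i _ => termE i)) -big_mkcond /=.
have lt_n : (n < (2 * n).+1)%N by lia.
by rewrite (big_pred1 (Ordinal lt_n)).
Qed.

Theorem corollary5p15 (R : realType) (n : nat) :
  ((#|L1o R (2 * n)|%:Z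
      = binom_pow_coef (2 * n) (nseq n neg1 ++ nseq n pos1)) /\
   (binom_pow_coef (2 * n) (nseq n neg1 ++ nseq n pos1)
      = #|Sigma1 (2 * n)|%:Z)) /\
  ((#|L1o R (2 * n)| = 'C(2 * n, n)) /\
   ('C(2 * n, n) = #|Sigma1 (2 * n)|)).
Proof. by rewrite card_L1o card_Sigma1 binom_pow_coef_central. Qed.
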